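(* Let $X$ be a paracompact space, $Y$ a complete metric space and $\Phi\colon X\to 2^Y$ a lower semi-continuous set-valued map with non-empty values. Then: (i) For every complete locally convex linear space $E$ there exists a linear operator $S_b\colon C_b(Y,E)\to C_b(X,E)$ such that $$S_b(f)(x)\in\overline{\mathrm{conv}}\,f(\Phi(x))\quad\text{for all } x\in X \text{ and } f\in C_b(Y,E),$$ and such that $S_b$ is continuous when both $C_b(Y,E)$ and $C_b(X,E)$ are equipped with the uniform topology, and also continuous when both are equipped with the topology of uniform convergence on compact sets. (ii) If $X$ is a $k$-space or $E$ is a Banach space, then $S_b$ can be extended to a linear operator $S\colon C(Y,E)\to C(X,E)$ such that $$S(f)(x)\in\overline{\mathrm{conv}}\,f(\Phi(x))\quad\text{for all } x\in X \text{ and } f\in C(Y,E),$$ and such that $S$ is continuous when both $C(Y,E)$ and $C(X,E)$ are equipped with the uniform topology, and also continuous when both are equipped with the topology of uniform convergence on compact sets.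
   Context: Paracompact spaces are Hausdorff. Locally convex linear spaces are real and Hausdorff; such a space is complete if every Cauchy net in it converges. For a topological space $X$ and a locally convex linear space $E$, $C(X,E)$ is the linear space of all continuous maps $X\to E$, and $C_b(X,E)\subset C(X,E)$ is the subspace of those maps whose image is bounded in $E$. The uniform topology is that of uniform convergence on the whole domain with respect to the standard uniformity of $E$; the topology of uniform convergence on compact sets is that of uniform convergence on each compact subset of the domain. $2^Y$ denotes the family of subsets of $Y$. A set-valued map $\Phi\colon X\to 2^Y$ is lower semi-continuous if $\{x\in X:\Phi(x)\cap U\neq\varnothing\}$ is open in $X$ for every open $U\subset Y$. The values of $\Phi$ are not assumed closed. $\overline{\mathrm{conv}}\,A$ denotes the closed convex hull of $A$ in $E$. A space $X$ is a $k$-space if its topology is determined by its compact subsets; in particular, a map from $X$ to any space is continuous if and only if its restriction to every compact subset of $X$ is continuous. *)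

(* Defs.v *)
From HB Require Import structures.
From mathcomp Require Import all_boot all_order all_algebra.
From mathcomp Require Import all_classical all_reals all_analysis.

Set Implicit Arguments.
Unset Strict Implicit.
Unset Printing Implicit Defensive.

Import Order.TTheory GRing.Theory Num.Theory.
Import numFieldNormedType.Exports.

Local Open Scope classical_set_scope.
Local Open Scope ring_scope.

Definition paracompact (X : topologicalType) : Prop :=
  hausdorff_space X /\
  forall U : set (set X), U `<=` open -> \bigcup_(A in U) A = [set: X] ->
    exists V : set (set X),
      [/\ V `<=` open,
          \bigcup_(B in V) B = [set: X],
          forall B, V B -> exists2 A, U A & B `<=` A
        & forall x : X, exists2 W, nbhs x W &
            finite_set [set B | V B /\ B `&` W !=set0]].

Definition lower_semi_continuous (X Y : topologicalType) (Phi : X -> set Y) :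
    Prop :=
  forall U : set Y, open U -> open [set x | Phi x `&` U !=set0].

Definition k_space (X : topologicalType) : Prop :=
  forall A : set X,
    (forall K : set X, compact K -> exists2 V, open V & A `&` K = V `&` K) ->
    open A.

(* Unlike the library's [completeType], this does not ask for a point, so that
   the empty space is allowed. *)
Definition complete_space (T : uniformType) : Prop :=
  forall F : set_system T, ProperFilter F -> cauchy F -> exists p : T, F --> p.

(* A [tvsType] carries some uniformity inducing its topology, which the library
   does not require to be translation invariant. *)
Definition standard_uniformity (R : numDomainType) (E : tvsType R) : Prop :=
  @entourage E =
    [set A | exists2 U, nbhs (0 : E) U & forall x y, U (x - y) -> A (x, y)].

Definition tvs_bounded (R : realType) (E : tvsType R) (A : set E) : Prop :=
  forall U, nbhs (0 : E) U -> \forall t \near +oo_R, A `<=` [set t *: u | u in U].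

Definition closed_convex_hull (R : numDomainType) (E : tvsType R) (A : set E) :
    set E :=
  smallest [set C : set E | closed C /\ convex_set C] A.

Definition is_norm (R : realType) (E : lmodType R) (N : E -> R) : Prop :=
  [/\ forall x, N x = 0 -> x = 0,
      forall a x, N (a *: x) = `|a| * N x
    & forall x y, N (x + y) <= N x + N y].

Definition banach_space (R : realType) (E : tvsType R) : Prop :=
  complete_space E /\
  exists2 N : E -> R, is_norm N &
    forall (x : E) (U : set E), nbhs x U <->
      exists2 e : R, 0 < e & [set y | N (x - y) < e] `<=` U.

(* The linear space C(X, E) is the library's [continuousType X E] with the
   pointwise operations. *)
Section continuous_maps.
Context (R : realType) (X : topologicalType) (E : tvsType R).

Definition cts_pred : {pred X -> E} := mem [set f : X -> E | continuous f].

Section Sub.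
Context (f : X -> E) (fP : f \in cts_pred).
#[local] HB.instance Definition _ := @isContinuous.Build X E f (set_mem fP).
Definition cts_Sub : continuousType X E := f.
End Sub.

Lemma cts_rect (K : continuousType X E -> Type) :
  (forall f (Pf : f \in cts_pred), K (cts_Sub Pf)) -> forall u, K u.
Proof.
move=> Ksub [f [[Pf]]].
have fP : f \in cts_pred by rewrite inE.
have -> : Pf = set_mem fP by exact: Prop_irrelevance.
exact: Ksub.
Qed.

Lemma cts_valP f (Pf : f \in cts_pred) : cts_Sub Pf = f :> (X -> E).
Proof. by []. Qed.

HB.instance Definition _ :=
  isSub.Build _ _ (continuousType X E) cts_rect cts_valP.

Lemma cts_submod_closed : submod_closed cts_pred.
Proof.
split; first by rewrite inE => x; exact: cvg_cst.
move=> a f g; rewrite !inE => cf cg x.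
apply: (@continuous_comp _ _ _ (fun x => (a *: f x, g x))
  (fun z : E * E => z.1 + z.2)); last exact: add_continuous.
apply: cvg_pair; last exact: cg.
apply: (@continuous_comp _ _ _ (fun x => (a : R^o, f x))
  (fun z : R^o * E => z.1 *: z.2)); last exact: scale_continuous.
by apply: (@cvg_pair _ _ _ _ (nbhs (a : R^o))); [exact: cvg_cst|exact: cf].
Qed.

HB.instance Definition _ :=
  GRing.isSubmodClosed.Build _ _ cts_pred cts_submod_closed.
HB.instance Definition _ :=
  [SubChoice_isSubLmodule of continuousType X E by <:].

End continuous_maps.

Section bounded_continuous_maps.
Context (R : realType) (X : topologicalType) (E : tvsType R).

Lemma tvs_boundedZ (a : R) (A : set E) :
  tvs_bounded A -> tvs_bounded [set a *: x | x in A].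
Proof.
move=> bA U U0.
have V0 : nbhs (0 : E) [set x | U (a *: x)].
  have := @scale_continuous _ E (a : R^o, 0); rewrite /continuous_at/= scaler0.
  move=> /(_ U U0)[B [B1 B2] BU].
  by apply: filterS B2 => x Bx; apply: (BU (a, x)); split => //; exact: nbhs_singleton.
apply: filterS (bA _ V0) => t At _ [x /At[u /= Uu <-] <-].
by exists (a *: u) => //; rewrite !scalerA mulrC.
Qed.

Lemma tvs_boundedD (A B : set E) :
  tvs_bounded A -> tvs_bounded B -> tvs_bounded [set x + y | x in A & y in B].
Proof.
move=> bA bB U U0.
have := @add_continuous E (0, 0); rewrite /continuous_at/= addr0.
move=> /(_ U U0)[V [V1 V2] VU].
apply: filterS2 (bA _ V1) (bB _ V2) => t At Bt _ [x /At[u Vu <-]] [y /Bt[v Vv <-]] <-.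
by exists (u + v); rewrite ?scalerDr//; exact: (VU (u, v)).
Qed.

Definition bounded_cts_pred : {pred continuousType X E} :=
  mem [set f : continuousType X E | tvs_bounded (range f)].

Lemma bounded_cts_submod_closed : submod_closed bounded_cts_pred.
Proof.
split.
  rewrite inE => U U0; apply: nearW => t _ [x _ <-].
  by exists 0; [exact: nbhs_singleton|rewrite scaler0].
move=> a f g; rewrite !inE => bf bg U U0.
apply: filterS (tvs_boundedD (@tvs_boundedZ a _ bf) bg U0) => t /= At _ [x _ <-].
apply: At; exists (a *: f x); first by exists (f x) => //; exists x.
by exists (g x) => //; exists x.
Qed.

HB.instance Definition _ :=
  GRing.isSubmodClosed.Build _ _ bounded_cts_pred bounded_cts_submod_closed.

(* C_b(X, E), as a linear subspace of C(X, E) *)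
Definition bounded_cts : Type := {f : continuousType X E | f \in bounded_cts_pred}.

HB.instance Definition _ := SubChoice.on bounded_cts.
HB.instance Definition _ := [SubChoice_isSubLmodule of bounded_cts by <:].

End bounded_continuous_maps.

Section topologies.
Context (R : realType) (X : topologicalType) (E : tvsType R).

Definition C_unif : Type :=
  initial_topology (fun f : continuousType X E => (f : {uniform X -> E})).
HB.instance Definition _ := Topological.on C_unif.

Definition C_cpt : Type :=
  initial_topology
    (fun f : continuousType X E => (f : {family (@compact X), X -> E})).
HB.instance Definition _ := Topological.on C_cpt.

Definition Cb_unif : Type :=
  initial_topology (fun f : bounded_cts X E => (val f : C_unif)).
HB.instance Definition _ := Topological.on Cb_unif.

Definition Cb_cpt : Type :=
  initial_topology (fun f : bounded_cts X E => (val f : C_cpt)).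
HB.instance Definition _ := Topological.on Cb_cpt.

End topologies.

(* Main.v *)
Require Import Defs.
From HB Require Import structures.
From mathcomp Require Import all_boot all_order all_algebra.
From mathcomp Require Import finmap.
From mathcomp Require Import all_classical all_reals all_analysis.

Set Implicit Arguments.
Unset Strict Implicit.
Unset Printing Implicit Defensive.

Import Order.TTheory GRing.Theory Num.Theory.
Import numFieldNormedType.Exports.

Local Open Scope classical_set_scope.
Local Open Scope ring_scope.

(** The operator is an average against probability measures on Y with compact
    support in the closure of the values of Phi, and these measures are limits
    of finitely supported ones carried by the levels of a tree.

    A node of the tree is a finite sequence s of points of Y, the last point
    being the head of the list.  It determines an open subset cell s of Y, the
    intersection of balls of radii 1, 1/2, 1/3, and so on around its points, and
    a closed subset active a s of X all of whose points x satisfy: Phi x meets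
    cell s.  Lower semi-continuity says that the sets of those x for which Phi x
    meets cell (y :: s) are open, and for y in cell s they cover active a s.
    Hence paracompactness of X gives a locally finite partition of unity
    (a s y), indexed by y, on active a s, and the children of s that are active
    at x are those y for which x is in the closed support of a s y
    (selection_tree_exists).

    For f : Y -> E let level_avg a f n x be the average of the values of f at
    the heads of the nodes of level n active at x, weighted by the products of
    the values at x of the partitions along the branches.  Each of these maps is
    continuous in x and linear in f.  The decisive point is that they form a
    locally uniformly Cauchy sequence, for every continuous f, bounded or not.
    Near a given x only finitely many nodes of each level are active, so
    Koenig's lemma applies: if f were not small on the cells of the nodes of some
    level, uniformly near x, there would be an infinite branch active at x along
    which f is never small; the cells of this branch shrink to a point of the
    complete space Y, at which f would fail to be continuous
    (eventually_smallP).  All nodes below a node s have their heads in cell s, so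
    the later averages differ little from the average at that level
    (level_avg_near_cauchy), and the limit is continuous in x.

    Replacing the head of each active node s by a point of Phi x in cell s
    changes the averages little, which puts the limit in the closed convex hull
    of f (Phi x).  If f takes its values in a convex neighbourhood V of 0, the
    limits lie in the closure of V; this gives continuity for uniform
    convergence.  For a compact K in X, each level has finitely many nodes active
    at some point of K, so the heads of these nodes form a totally bounded set;
    its closure is compact and carries all the averages at points of K, whence
    continuity for uniform convergence on compact sets.  The operator on bounded
    maps is the restriction of the operator on all continuous maps. *)

(** * Paracompact spaces and compact sets *)

Definition locally_finite (X : topologicalType) (I : Type) (D : set I)
    (V : I -> set X) : Prop :=
  forall x : X, exists2 W, nbhs x W & finite_set [set i | D i /\ V i `&` W !=set0].

(** A neighbourhood of x that meets finitely many members of the family reduces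
    the claim to finite unions of closed sets. *)
Lemma closure_locally_finite (X : topologicalType) (I : choiceType) (D : set I)
    (V : I -> set X) : locally_finite D V ->
  closure (\bigcup_(i in D) V i) `<=` \bigcup_(i in D) closure (V i).
Proof.
move=> lfV x xV; have [W xW finW] := lfV x.
suff : (\bigcup_(i in [set i | D i /\ V i `&` W !=set0]) closure (V i)) x.
  by move=> [i [Di _] Vix]; exists i.
apply: (closed_bigcup finW) => [i _|]; first exact: closed_closure.
move=> N xN; have [z [[i Di Viz] [Wz Nz]]] := xV _ (filterI xW xN).
exists z; split => //; exists i; last exact: subset_closure.
by split => //; exists z.
Qed.

Lemma locally_finite_closure (X : topologicalType) (I : choiceType) (D : set I)
    (V : I -> set X) : locally_finite D V ->
  locally_finite D (fun i => closure (V i)).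
Proof.
move=> lfV x; have [W xW finW] := lfV x.
exists W°; first exact: nbhs_interior.
apply: sub_finite_set finW => i [Di [z [Viz Wz]]]; split=> //.
exact: Viz.
Qed.

Lemma locally_finite_sub (X : topologicalType) (I : choiceType) (D : set I)
    (V V' : I -> set X) : (forall i, V' i `<=` V i) ->
  locally_finite D V -> locally_finite D V'.
Proof.
move=> V'V lfV x; have [W xW finW] := lfV x; exists W => //.
apply: sub_finite_set finW => i [Di [z [V'iz Wz]]]; split=> //.
by exists z; split=> //; exact: V'V.
Qed.

Section paracompact.
Context (X : topologicalType) (X_paracompact : paracompact X).

(** Regularity and normality follow the same scheme: with D a point it upgrades
    the Hausdorff property to the separation of points from closed sets, and with
    D arbitrary it upgrades the latter to normality.  The members of a fine
    locally finite cover that meet C have closures disjoint from D, and so has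
    their union, by local finiteness. *)
Lemma paracompact_separation (C D : set X) : closed C ->
    (forall y, C y -> exists V, [/\ open V, V y & closure V `&` D = set0]) ->
  exists V, [/\ open V, C `<=` V & closure V `&` D = set0].
Proof.
move=> cC CD; have [_ /(_ [set V | open V /\ (closure V `&` D = set0 \/ V `<=` ~` C)])] := X_paracompact.
case; first by move=> V [].
  apply/seteqP; split=> // x _; have [Cx|nCx] := pselect (C x).
    by have [V [oV Vx VD]] := CD x Cx; exists V => //=; split => //; left.
  by exists (~` C) => //=; split; [exact: closed_openC|right].
move=> V [oV coV refV lfV].
pose P := [set B | V B /\ B `&` C !=set0].
exists (\bigcup_(B in P) B); split.
- by apply: bigcup_open => B [VB _]; exact: oV.
- move=> x Cx; have : [set: X] x by []. rewrite -coV => -[B VB Bx].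
  by exists B => //; split => //; exists x.
- apply/seteqP; split=> // x [+ Dx].
  have lfP : locally_finite P id.
    move=> z; have [W zW finW] := lfV z; exists W => //.
    by apply: sub_finite_set finW => B [[VB _] BW].
  move=> /(closure_locally_finite lfP)[B [VB [z [Bz Cz]]] Bx].
  have [A [oA [AD|AC]] BA] := refV B VB.
    have : (closure A `&` D) x by split => //; exact: closureS Bx.
    by rewrite AD.
  by have /= := AC z (BA z Bz).
Qed.

Lemma paracompact_point_regular (x : X) (D : set X) : closed D -> ~ D x ->
  exists V, [/\ open V, V x & closure V `&` D = set0].
Proof.
move=> cD nDx.
have [] := @paracompact_separation D [set x] cD.
  move=> y Dy; have [h _] := X_paracompact; rewrite open_hausdorff in h.
  have [|[A B] [/= xA yB] [oA oB /eqP AB]] := h x y.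
    by apply/eqP => xy; apply: nDx; rewrite xy.
  exists B; split => //; first by rewrite inE in yB.
  apply/seteqP; split=> // z [cBz /= zx]; rewrite zx in cBz.
  rewrite inE in xA; have [|w [Bw Aw]] := cBz A; first exact: open_nbhs_nbhs.
  by have : (A `&` B) w by []; rewrite AB.
move=> V [oV DV Vx]; exists (~` closure V); split.
- by apply: closed_openC; exact: closed_closure.
- by move=> Vx'; have : (closure V `&` [set x]) x by []; rewrite Vx.
- apply/seteqP; split=> // z [+ Dz]; rewrite closure_setC; apply.
  by apply: interiorS (@subset_closure _ V) _ _; rewrite (interior_id _).1//; exact: DV.
Qed.

Lemma paracompact_normal : normal_space X.
Proof.
move=> A cA B /set_nbhsP[C [oC AC CB]].
have [|V [oV AV VC]] := @paracompact_separation A (~` C) cA.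
  by move=> y /AC Cy; apply: paracompact_point_regular; [rewrite closedC|apply].
exists V; first by apply/set_nbhsP; exists V; split.
move=> z Vz; apply: CB; apply: contrapT => nCz.
by have : (closure V `&` ~` C) z by []; rewrite VC.
Qed.

(** Each member of a locally finite refinement whose closures lie in members of U
    is assigned to one index i; the union of those assigned to i is V i. Keeping
    the index type of U is what lets the children of a node be points of Y. *)
Lemma paracompact_shrink (I : Type) (F : set X) (U : I -> set X) :
    closed F -> (forall i, open (U i)) -> F `<=` \bigcup_i U i ->
  exists V : I -> set X, [/\ forall i, open (V i), F `<=` \bigcup_i V i,
    forall i, closure (V i) `<=` U i & locally_finite setT V].
Proof.
move=> cF oU FU; have [_ /(_ [set V | open V /\
  ((exists i, closure V `<=` U i) \/ V `<=` ~` F)])] := X_paracompact.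
case; first by move=> V [].
  apply/seteqP; split=> // x _; have [Fx|nFx] := pselect (F x); last first.
    by exists (~` F) => //=; split; [exact: closed_openC|right].
  have [i _ Uix] := FU x Fx.
  have [||V [oV Vx VU]] := @paracompact_point_regular x (~` U i).
  - by rewrite closedC.
  - by [].
  exists V => //=; split=> //; left; exists i => z Vz; apply: contrapT => nUz.
  by have : (closure V `&` ~` U i) z by []; rewrite VU.
move=> W [oW coW refW lfW].
have refW' B : W B -> exists o : option I,
    if o is Some i then closure B `<=` U i else B `<=` ~` F.
  move=> /refW[A [_ [[i AU]|AF]] BA].
    by exists (Some i); exact: subset_trans (closureS BA) AU.
  by exists None; exact: subset_trans BA AF.
have [c cP] : {c : set X -> option I & forall B, W B ->
    if c B is Some i then closure B `<=` U i else B `<=` ~` F}.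
  apply: (@choice _ _ (fun B o => W B -> if o is Some i then closure B `<=` U i
    else B `<=` ~` F)) => B.
  have [WB|nWB] := pselect (W B); last by exists None.
  by have [j jP] := refW' B WB; exists j.
pose V i := \bigcup_(B in [set B | W B /\ c B = Some i]) B.
have lf i : locally_finite [set B | W B /\ c B = Some i] id.
  move=> x; have [N xN finN] := lfW x; exists N => //.
  by apply: sub_finite_set finN => B [[WB _] BN].
exists V; split.
- by move=> i; apply: bigcup_open => B [/oW].
- move=> x Fx; have : [set: X] x by []. rewrite -coW => -[B WB Bx].
  have := cP B WB; case cB : (c B) => [i|]; last by move=> /(_ x Bx).
  by move=> _; exists i => //; exists B.
- move=> i x /(closure_locally_finite (lf i))[B [WB cB] Bx].
  by have := cP B WB; rewrite cB; apply.
- move=> x; have [N xN finN] := lfW x; exists N => //.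
  apply: (@sub_finite_set _ _ (\bigcup_(B in [set B | W B /\ B `&` N !=set0])
    [set i | c B = Some i])).
    move=> i [_ [z [[B [WB cB] Bz] Nz]]]; exists B => //.
    by split=> //; exists z.
  apply: bigcup_finite => // B _; case: (c B) => [j|].
    by apply: sub_finite_set (finite_set1 j) => i /= [->].
  by apply: sub_finite_set (finite_set0 _) => i.
Qed.

End paracompact.

(** The neighbourhoods that witness local finiteness are amalgamated over K by the
    near-covering form of compactness, applied to the filter of sets of indices
    that contain a given finite one. *)
Lemma locally_finite_compact (X : topologicalType) (I : choiceType)
    (V : I -> set X) (K : set X) : locally_finite setT V -> compact K ->
  finite_set [set i | V i `&` K !=set0].
Proof.
move=> lfV /compact_near_coveringP cK.
pose F := filter_from (@finite_set I) (fun B => [set B' | B `<=` B']).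
have FF : Filter F.
  apply: filter_from_filter => [|A B finA finB]; first by exists set0.
  exists (A `|` B); first by rewrite finite_setU.
  by move=> C ABC; split => i ?; apply: ABC; [left|right].
have [|B finB BP] := cK _ F (fun B x => forall i, V i x -> B i) FF.
  move=> x _; have [W xW finW] := lfV x.
  exists (W, [set B | [set i | setT i /\ V i `&` W !=set0] `<=` B]).
    by split => //=; exists [set i | setT i /\ V i `&` W !=set0].
  by move=> [z B] /= [Wz WB] i Viz; apply: WB; split=> //; exists z.
apply: sub_finite_set finB => i [z [Vz Kz]].
exact: (BP B (@subset_refl _ B) z Kz i Vz).
Qed.

Lemma ultra_bigcup (T : Type) (I : choiceType) (F : set_system T) (D : set I)
    (A : I -> set T) : UltraFilter F -> finite_set D ->
  F (\bigcup_(i in D) A i) -> exists2 i, D i & F (A i).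
Proof.
move=> UF finD FA; apply: contrapT => nA.
have nFA i : i \in fset_set D -> F (~` A i).
  rewrite in_fset_set// inE => Di; have [FAi|//] := in_ultra_setVsetC (A i) UF.
  by exfalso; apply: nA; exists i.
have [z [[i Di Az] nAz]] := filter_ex (filterI FA (@filter_bigI _ _ _ _ F _ nFA)).
by apply: (nAz i) => //=; rewrite in_fset_set// inE.
Qed.

(** An ultrafilter containing the closure of L contains, for each e, one of the
    finitely many balls that cover it, hence is Cauchy. *)
Lemma totally_bounded_compact (R : realType) (Y : pseudoMetricType R) (L : set Y) :
    complete_space Y ->
    (forall e : R, 0 < e -> exists2 B : set Y, finite_set B &
      L `<=` \bigcup_(b in B) ball b e) ->
  compact (closure L).
Proof.
move=> Yc tbL; rewrite compact_ultra => F UF FL.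
have [|p Fp] := Yc F (@ultra_proper _ _ UF).
  apply: cauchy_exP => e e0.
  have [|B finB LB] := tbL (e / 2); first by rewrite divr_gt0.
  suff : F (\bigcup_(b in B) ball b e) by move=> /(ultra_bigcup UF finB)[b _]; exists b.
  apply: filterS FL => z /(_ (ball z (e / 2)))[|w [Lw zw]].
    by apply: nbhsx_ballx; rewrite divr_gt0.
  have [b Bb bw] := LB w Lw; exists b => //.
  by apply: ball_splitl bw _.
exists p; split => //.
by rewrite (closure_id (closure L)).1; [|exact: closed_closure]; move=> N /Fp FN; exact: filter_ex (filterI FL FN).
Qed.

(** * Convex combinations and partitions of unity *)
Section weighted_sum.
Context (R : realType) (E : lmodType R) (I : choiceType).
Implicit Types (a : I -> R) (v w : I -> E).

Definition wsum a v : E := \sum_(i \in [set: I]) a i *: v i.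

Lemma wsum_fset (A : set I) a v : finite_set A -> [set i | a i != 0] `<=` A ->
  wsum a v = \sum_(i <- fset_set A) a i *: v i.
Proof.
move=> finA aA; rewrite -fsbig_finite//; symmetry; apply: fsbig_widen => //.
move=> i [_ nAi] /=; have [->|/aA//] := eqVneq (a i) 0.
by rewrite scale0r.
Qed.

Lemma wsum_linear a v w (k : R) : finite_set [set i | a i != 0] ->
  wsum a (fun i => k *: v i + w i) = k *: wsum a v + wsum a w.
Proof.
move=> fina; rewrite !(wsum_fset _ fina)// scaler_sumr -big_split/=.
by apply: eq_bigr => i _; rewrite scalerDr !scalerA mulrC.
Qed.

Lemma eq_wsum a v w : (forall i, a i != 0 -> v i = w i) -> wsum a v = wsum a w.
Proof.
move=> vw; apply: eq_fsbigr => i _.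
by have [->|/vw->//] := eqVneq (a i) 0; rewrite !scale0r.
Qed.

Lemma convex_setP (C : set E) (x y : E) (s t : R) : convex_set C ->
  0 <= s -> 0 <= t -> s + t = 1 -> C x -> C y -> C (s *: x + t *: y).
Proof.
move=> cC s0 t0 st Cx Cy; have s1 : s <= 1 by rewrite -st lerDl.
have := cC x y (Itv01 s0 s1); rewrite !inE => /(_ Cx Cy).
rewrite /conv/= /unstable.onem. by rewrite -st [s + t]addrC addrK.
Qed.

(** Induction on the support shows that a sum with total weight t is t times a
    point of C, which avoids normalizing the weights of partial sums. *)
Lemma wsum_convex (C : set E) a v : convex_set C -> (forall i, 0 <= a i) ->
  finite_set [set i | a i != 0] -> \sum_(i \in [set: I]) a i = 1 ->
  (forall i, a i != 0 -> C (v i)) -> C (wsum a v).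
Proof.
move=> cC a0 fina; rewrite (wsum_fset _ fina)//.
have -> : \sum_(i \in [set: I]) a i = \sum_(i <- fset_set [set i | a i != 0]) a i.
  rewrite -fsbig_finite//; symmetry; apply: fsbig_widen => // i [_].
  by move=> /negP; rewrite negbK => /eqP.
move=> a1 vC.
have [i0 ai0] : exists i, a i != 0.
  apply/not_existsP => h; move: a1; rewrite big1 => [|i _].
    by move/eqP; rewrite eq_sym oner_eq0.
  by have /negP := h i; rewrite negbK => /eqP.
suff : exists2 c, C c & \sum_(i <- fset_set [set i | a i != 0]) a i *: v i =
    (\sum_(i <- fset_set [set i | a i != 0]) a i) *: c.
  by move=> [c Cc ->]; rewrite a1 scale1r.
move: (finmap.enum_fset _) => s; elim: s {a1} => [|i s [c Cc sc]].
  by exists (v i0); [exact: vC|rewrite !big_nil scale0r].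
rewrite !big_cons sc; set t := \sum_(i <- s) a i.
have t0 : 0 <= t by exact: sumr_ge0.
have [->|ai] := eqVneq (a i) 0; first by exists c; rewrite ?scale0r ?add0r.
have p : 0 < a i + t by rewrite ltr_wpDr// lt_neqAle eq_sym ai a0.
exists ((a i / (a i + t)) *: v i + (t / (a i + t)) *: c).
  apply: convex_setP => //; last exact: vC.
  - by rewrite divr_ge0// ltW.
  - by rewrite divr_ge0// ltW.
  - by rewrite -mulrDl divff// gt_eqF.
rewrite scalerDr !scalerA ![(a i + t) * _]mulrC !divfK// gt_eqF//.
Qed.

End weighted_sum.

Lemma continuous_wsum (R : realType) (E : tvsType R) (X : topologicalType)
    (I : choiceType) (a : I -> X -> R) (v : I -> X -> E) :
    (forall i, continuous (a i)) -> (forall i, continuous (v i)) ->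
    locally_finite setT (fun i => [set x | a i x != 0]) ->
  continuous (fun x => wsum (a^~ x) (v^~ x)).
Proof.
move=> ca cv lfa x; have [W xW finW] := lfa x.
set A := [set i | _] in finW.
have wE z : W z -> wsum (a^~ z) (v^~ z) = \sum_(i <- fset_set A) a i z *: v i z.
  move=> Wz; apply: wsum_fset => // i /= ai; split=> //; by exists z.
rewrite /continuous_at (wE x (nbhs_singleton xW)).
apply: (@cvg_trans _ ((fun z => \sum_(i <- fset_set A) a i z *: v i z) @ x)).
  by apply: near_eq_cvg; apply: filterS xW => z /wE.
apply: cvg_big => [|i _]; first exact: add_continuous.
apply: (@continuous_comp _ _ _ (fun x => (a i x : R^o, v i x))
  (fun z : R^o * E => z.1 *: z.2)); last exact: scale_continuous.
by apply: (@cvg_pair _ _ _ _ (nbhs (a i x : R^o))); [exact: ca|exact: cv].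
Qed.

Definition partition_on (R : realType) (X : topologicalType) (I : choiceType)
    (F : set X) (U : I -> set X) (a : I -> X -> R) : Prop :=
  [/\ forall i, continuous (a i), forall i x, 0 <= a i x,
      forall i, closure [set x | a i x != 0] `<=` U i,
      locally_finite setT (fun i => [set x | a i x != 0])
    & forall x, F x -> \sum_(i \in [set: I]) a i x = 1].

(** Shrinking twice leaves room for Urysohn functions g i equal to 1 on closed
    sets that still cover F and whose closed supports lie in U i.  Their sum G is
    at least 1 on F, so dividing by the maximum of G and 1 normalizes them on F
    and keeps them continuous everywhere. *)
Lemma paracompact_partition (R : realType) (X : topologicalType)
    (I : choiceType) (F : set X) (U : I -> set X) :
    paracompact X -> closed F -> (forall i, open (U i)) -> F `<=` \bigcup_i U i ->
  exists a : I -> X -> R, partition_on F U a.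
Proof.
move=> pX cF oU FU.
have [V [oV FV VU lfV]] := paracompact_shrink pX cF oU FU.
have [V' [_ FV' V'V _]] := paracompact_shrink pX cF oV FV.
pose g i : X -> R := Urysohn (~` V i) (closure (V' i)).
have us i : uniform_separator (~` V i) (closure (V' i)).
  apply: (@normal_separatorP R X).1; first exact: paracompact_normal.
  - by rewrite closedC.
  - exact: closed_closure.
  - by apply/seteqP; split=> // x [nVx /V'V].
have g0 i x : g i x != 0 -> V i x.
  move=> gx; apply: contrapT => nVx; move/eqP : gx; apply.
  by apply: (Urysohn_sub0 (us i)); exists x.
have g1 i x : V' i x -> g i x = 1.
  move=> /subset_closure Vx; by apply: (Urysohn_sub1 (us i)); exists x.
have gge0 i x : 0 <= g i x.
  have : `[0, 1]%classic (g i x) by apply: (@Urysohn_range _ R (~` V i) (closure (V' i))); exists x.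
  by rewrite /= in_itv/= => /andP[].
have cg i : continuous (g i) by exact: Urysohn_continuous.
have lfg : locally_finite setT (fun i => [set x | g i x != 0]).
  by apply: locally_finite_sub lfV => i x /g0.
pose G x : R := wsum (g^~ x) (fun=> 1 : R^o).
have cG : continuous G.
  by apply: (@continuous_wsum R R^o) => // i x; exact: cvg_cst.
pose m x := Num.max (G x) 1.
have m0 x : 0 < m x by rewrite lt_max ltr01 orbT.
have cm : continuous m.
  by move=> x; apply: (@continuous_max _ _ _ (fun=> 1)); [exact: cG|exact: cvg_cst].
have a0 i x : (g i x / m x != 0) = (g i x != 0).
  by rewrite mulf_eq0 invr_eq0 (gt_eqF (m0 x)) orbF.
exists (fun i x => g i x / m x); split.
- move=> i x; apply: cvgM; first exact: cg.
  by apply: cvgV; [rewrite gt_eqF|exact: cm].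
- by move=> i x; rewrite divr_ge0// ltW.
- move=> i; apply: subset_trans (VU i); apply: closureS => x /=.
  by rewrite a0 => /g0.
- by apply: locally_finite_sub lfg => i x /=; rewrite a0.
- move=> x Fx.
  have [W xW finW] := lfg x.
  have fing : finite_set [set i | g i x != 0].
    apply: sub_finite_set finW => i /= gix; split => //; exists x; split => //.
    exact: nbhs_singleton.
  have GE : G x = \sum_(i <- fset_set [set i | g i x != 0]) g i x.
    rewrite /G (wsum_fset _ fing)//; apply: eq_bigr => i _.
    by rewrite /GRing.scale/= mulr1.
  have G1 : 1 <= G x.
    have [i _ V'i] := FV' x Fx.
    rewrite GE (big_rem i)/=; last by rewrite in_fset_set// inE/= g1// oner_neq0.
    by rewrite g1// lerDl sumr_ge0.
  rewrite -(fsbig_widen [set i | g i x != 0])// => [|i [_ /negP]]; last first.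
    by rewrite negbK/= => /eqP ->; rewrite mul0r.
  rewrite fsbig_finite// -mulr_suml -GE /m max_l// divff// gt_eqF//.
  exact: lt_le_trans G1.
Qed.

(** * Locally convex spaces *)
Section locally_convex.
Context (R : realType) (E : tvsType R).
Implicit Types (U V : set E).

Lemma tvs_cvgD (T : Type) (F : set_system T) (FF : Filter F) (u v : T -> E) a b :
  u @ F --> a -> v @ F --> b -> (fun t => u t + v t) @ F --> a + b.
Proof.
move=> ua vb; apply: (@cvg_comp _ _ _ (fun t => (u t, v t))
  (fun z : E * E => z.1 + z.2)); last exact: (@add_continuous E (a, b)).
exact: cvg_pair.
Qed.

Lemma tvs_cvgZ (T : Type) (F : set_system T) (FF : Filter F) (u : T -> E) k a :
  u @ F --> a -> (fun t => k *: u t) @ F --> k *: a.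
Proof.
move=> ua; apply: (@cvg_comp _ _ _ u (fun x : E => k *: x) _ _ _ ua).
apply: (@continuous_comp _ _ _ (fun x => (k : R^o, x))
  (fun z : R^o * E => z.1 *: z.2)); last exact: scale_continuous.
by apply: (@cvg_pair _ _ _ _ (nbhs (k : R^o))); [exact: cvg_cst|exact: cvg_id].
Qed.

Lemma tvs_cvgB (T : Type) (F : set_system T) (FF : Filter F) (u v : T -> E) a b :
  u @ F --> a -> v @ F --> b -> (fun t => u t - v t) @ F --> a - b.
Proof.
move=> ua vb; apply: tvs_cvgD => //.
by apply: (@cvg_comp _ _ _ v -%R _ _ _ vb); exact: opp_continuous.
Qed.

Lemma nbhs_subl (p : E) U : nbhs 0 U -> \forall x \near p, U (x - p).
Proof.
move=> U0; have : (fun x => x - p) @ p --> p - p.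
  by apply: tvs_cvgB; [exact: cvg_id|exact: cvg_cst].
by rewrite subrr; apply.
Qed.

Lemma nbhs0_addr (p : E) U : nbhs p U -> \forall v \near (0 : E), U (p + v).
Proof.
move=> Up; have : (fun v => p + v) @ (0 : E) --> p + 0.
  by apply: tvs_cvgD; [exact: cvg_cst|exact: cvg_id].
by rewrite addr0; apply.
Qed.

Lemma nbhs0_split U : nbhs 0 U -> exists2 V, nbhs (0 : E) V &
  forall x y, V x -> V y -> U (x + y) /\ U (x - y).
Proof.
move=> U0.
have := @add_continuous E (0, 0); rewrite /continuous_at/= addr0.
move=> /(_ U U0)[A [A1 A2] AU].
have := @sub_continuous E (0, 0); rewrite /continuous_at/= subrr.
move=> /(_ U U0)[B [B1 B2] BU].
exists ((A.1 `&` A.2) `&` (B.1 `&` B.2)).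
  by apply: filterI; apply: filterI.
move=> x y [[? ?] [? ?]] [[? ?] [? ?]]; split.
  by apply: (AU (x, y)).
by apply: (BU (x, y)).
Qed.

(** Convexity of V is what averages preserve and the closure of V is what limits
    preserve, so that all limits of averages of points of V remain in U. *)
Lemma nbhs0_convex U : nbhs 0 U ->
  exists V, [/\ nbhs (0 : E) V, convex_set V & closure V `<=` U].
Proof.
move=> /nbhs0_split[W W0 WU].
have [B Bconv [oB /(_ 0 W W0)[V [BV V0] /= VW]]] := @locally_convex R E.
exists V; split.
- by apply: open_nbhs_nbhs; split => //; exact: oB.
- by apply: Bconv; rewrite inE.
- move=> z /(_ _ (nbhs_subl z W0))[w [Vw Wwz]].
  by have [_] := WU _ _ (VW w Vw) Wwz; rewrite opprB addrC subrK.
Qed.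

Lemma convex_set_translate V (p : E) : convex_set V ->
  convex_set [set x | V (x - p)].
Proof.
move=> cV x y k; rewrite !inE/= => Vx Vy.
have := cV _ _ k (mem_set Vx) (mem_set Vy); rewrite inE /conv/=.
by rewrite !scalerBr addrACA -opprD -scalerDl unstable.add_onemK scale1r.
Qed.

Context (E_std : standard_uniformity E) (E_complete : complete_space E).

Lemma tvs_cauchy_cvg (u : nat -> E) :
    (forall U, nbhs (0 : E) U -> exists N, forall m, (N <= m)%N -> U (u m - u N)) ->
  exists p : E, u n @[n --> \oo] --> p.
Proof.
move=> cu; have PF : ProperFilter (u @ \oo) by exact: _.
apply: (E_complete PF).
move=> A; rewrite E_std => -[U /nbhs0_split[V V0 VU] UA].
have [N uN] := cu V V0.
exists ([set x | V (x - u N)], [set x | V (x - u N)]) => /=.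
  by split; exists N => // m /uN.
move=> [x y] /= [Vx Vy]; apply: UA.
have [_] := VU _ _ Vx Vy; by rewrite opprB addrA subrK.
Qed.

End locally_convex.

(** * The tree of locally finite partitions of unity *)
Section cells.
Context (R : realType) (Y : metricType R).

Lemma cell_radius_center (y : Y) n : (ball y n.+1%:R^-1)° y.
Proof.
by apply: nbhs_singleton; apply: nbhs_interior; apply: nbhsx_ballx; rewrite invr_gt0.
Qed.

Lemma small_radius (e : R) : 0 < e -> exists n, n.+1%:R^-1 < e.
Proof.
move=> e0; exists (Num.truncn e^-1); rewrite invf_plt ?posrE//.
exact: truncnS_gt.
Qed.

(** Any radii decreasing to 0 with the depth would do; taking interiors makes cells
    open by construction. *)
Fixpoint cell (s : seq Y) : set Y :=
  if s is y :: s' then cell s' `&` (ball y (size s').+1%:R^-1)° else setT.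

Lemma open_cell s : open (cell s).
Proof. by elim: s => [|y s IH]; [exact: openT|apply: openI => //; exact: open_interior]. Qed.

Lemma cell_cat t s : cell (t ++ s) `<=` cell s.
Proof. by elim: t => //= y t IH z [/IH]. Qed.

End cells.

Section tree.
Context (R : realType) (X : topologicalType) (Y : metricType R).
Context (Phi : X -> set Y).

(** Closed supports, rather than the sets where the weights do not vanish, keep
    the active sets closed: a node inactive at x is inactive near x. *)
Fixpoint active (a : seq Y -> Y -> X -> R) (s : seq Y) : set X :=
  if s is y :: s' then active a s' `&` closure [set x | a s' y x != 0] else setT.

(** Requiring y to lie in cell s makes the heads of all nodes below s lie in
    cell s, whereas meeting Phi x alone would only keep them close to it. *)
Definition selection_tree (a : seq Y -> Y -> X -> R) : Prop :=
  forall s, partition_on (active a s)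
    (fun y => [set x | cell s y /\ Phi x `&` cell (y :: s) !=set0]) (a s).

Lemma closed_active a s : closed (active a s).
Proof.
by elim: s => [|y s IH] /=; [exact: closedT|apply: closedI => //; exact: closed_closure].
Qed.

Lemma active_cat a t s : active a (t ++ s) `<=` active a s.
Proof. by elim: t => //= y t IH z [/IH]. Qed.

(** The partition at s depends on the active set of s, which depends on the
    partitions at the proper tails of s: a function choosing a partition for every
    node and every admissible closed set is fixed first, and the active sets are
    then defined by recursion on s. *)
Lemma selection_tree_exists : paracompact X -> lower_semi_continuous Phi ->
  (forall x, Phi x !=set0) -> exists a, selection_tree a.
Proof.
move=> pX lsc Phi0.
pose U s y := [set x : X | cell s y /\ Phi x `&` cell (y :: s) !=set0].
have oU s y : open (U s y).
  have [sy|nsy] := pselect (cell s y).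
    rewrite (_ : U s y = [set x | Phi x `&` cell (y :: s) !=set0]).
      by apply: lsc; exact: open_cell.
    by apply/seteqP; split => x => [[]|].
  rewrite (_ : U s y = set0); first exact: open0.
  by apply/seteqP; split => x // [].
have h (sF : seq Y * set X) : exists b : Y -> X -> R,
    closed sF.2 -> sF.2 `<=` [set x | Phi x `&` cell sF.1 !=set0] ->
    partition_on sF.2 (U sF.1) b.
  case: sF => s F /=; have [cF|ncF] := pselect (closed F); last by exists (fun _ _ => 0).
  have [FPhi|nF] := pselect (F `<=` [set x | Phi x `&` cell s !=set0]); last first.
    by exists (fun _ _ => 0).
  have [|b bP] := @paracompact_partition R X Y F (U s) pX cF (oU s).
    move=> x /FPhi[y [Phixy sy]]; exists y => //; split => //; exists y; split => //.
    by split => //; exact: cell_radius_center.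
  by exists b.
have [c cP] := choice h.
(* The active sets of the tree, before its weights are available. *)
pose fix act (s : seq Y) : set X :=
  if s is y :: s' then act s' `&` closure [set x | c (s', act s') y x != 0] else setT.
exists (fun s => c (s, act s)).
have actE s : active (fun s => c (s, act s)) s = act s by elim: s => //= y s ->.
have closed_act s : closed (act s) by rewrite -actE; exact: closed_active.
suff part : forall s, act s `<=` [set x | Phi x `&` cell s !=set0].
  by move=> s; rewrite actE; exact: (cP (s, act s) (closed_act s) (part s)).
elim=> [|y s IH] x /=.
  by move=> _; have [z] := Phi0 x; exists z.
move=> [_ yx]; have [_ _ /(_ y x yx) + _ _] := cP (s, act s) (closed_act s) IH.
by move=> [].
Qed.

End tree.

Section tree_theory.
Context (R : realType) (X : topologicalType) (Y : metricType R).
Context (Phi : X -> set Y) (Phi0 : forall x, Phi x !=set0).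
Context (a : seq Y -> Y -> X -> R) (aP : selection_tree Phi a).

Lemma active_meets s x : active a s x -> Phi x `&` cell s !=set0.
Proof.
case: s => [_|y s [_ yx]]; first by have [z] := Phi0 x; exists z.
by have [_ _ /(_ y x yx) [] ] := aP s.
Qed.

Lemma active_cell s y x : active a (y :: s) x -> cell (y :: s) y.
Proof.
move=> [_ yx]; have [_ _ /(_ y x yx) [sy _] _ _] := aP s; split => //.
exact: cell_radius_center.
Qed.

Lemma active_cons s y x : active a s x -> a s y x != 0 -> active a (y :: s) x.
Proof. by move=> sx yx; split => //; exact: subset_closure. Qed.

Lemma active_locally_finite s : locally_finite setT (fun y => active a (y :: s)).
Proof.
have [_ _ _ /locally_finite_closure + _] := aP s.
by apply: locally_finite_sub => y x [].
Qed.

Lemma finite_weights s x : finite_set [set y | a s y x != 0].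
Proof.
have [_ _ _ /(_ x)[W xW finW] _] := aP s.
apply: sub_finite_set finW => y /= yx; split => //; exists x; split => //.
exact: nbhs_singleton.
Qed.

Section average.
Context (E : tvsType R).
Implicit Types (g h : seq Y -> X -> E).

Fixpoint avg n g (s : seq Y) (x : X) : E :=
  if n is n'.+1 then wsum (a s ^~ x) (fun y => avg n' g (y :: s) x) else g s x.

Lemma avg_convex n g s x (C : set E) : convex_set C -> active a s x ->
    (forall t, size t = n -> active a (t ++ s) x -> C (g (t ++ s) x)) ->
  C (avg n g s x).
Proof.
move=> cC; elim: n s => [|n IH] s sx gC /=; first exact: (gC [::]).
have [_ a0 _ _ a1] := aP s.
apply: wsum_convex => //; first exact: finite_weights.
  exact: a1.
move=> y yx; apply: IH; first exact: active_cons.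
by move=> t tn tx; rewrite -cat_rcons; apply: gC; rewrite ?size_rcons ?tn// cat_rcons.
Qed.

Lemma avg_linear n g h s x (k : R) :
  avg n (fun s x => k *: g s x + h s x) s x = k *: avg n g s x + avg n h s x.
Proof.
elim: n s => //= n IH s; rewrite -wsum_linear; last exact: finite_weights.
by apply: eq_wsum => y _.
Qed.

(** Later averages are averages, over level m, of averages over the subtrees. *)
Lemma avg_add m n g s x : avg (m + n) g s x = avg m (avg n g) s x.
Proof. by elim: m s => //= m IH s; apply: eq_wsum => y _. Qed.

Lemma continuous_avg n g s : (forall s, continuous (g s)) -> continuous (avg n g s).
Proof.
move=> cg; elim: n s => //= n IH s.
have [ca _ _ lfa _] := aP s.
exact: (@continuous_wsum _ _ _ _ (a s) (fun y => avg n g (y :: s))).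
Qed.

End average.
End tree_theory.

(** * Convergence of the averages *)
Section limit.
Context (R : realType) (X : topologicalType) (Y : metricType R).
Context (Y_complete : complete_space Y).
Context (Phi : X -> set Y) (Phi0 : forall x, Phi x !=set0).
Context (a : seq Y -> Y -> X -> R) (aP : selection_tree Phi a).
Context (E : tvsType R).

Definition small_on (f : Y -> E) (V : set E) (s : seq Y) : Prop :=
  forall z z', cell s z -> cell s z' -> V (f z - f z').

Lemma small_on_cat f V t s : small_on f V s -> small_on f V (t ++ s).
Proof. by move=> fV z z' /cell_cat sz /cell_cat sz'; exact: fV. Qed.

(** Smallness at one depth n below s, uniformly for the points x' near x: the
    single depth is what makes this property pass from the children to s only when
    finitely many children matter. *)
Definition eventually_small (f : Y -> E) (V : set E) (x : X) (s : seq Y) : Prop :=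
  exists n, \forall x' \near x, forall t, size t = n ->
    active a (t ++ s) x' -> small_on f V (t ++ s).

(** The step of Koenig's lemma: a bad node has a bad child active at x.  Otherwise
    all the children active near x are good; they are finitely many, so that the
    largest of their depths and the intersection of their neighbourhoods serve
    for s. *)
Lemma eventually_small_step f V x s : active a s x -> ~ eventually_small f V x s ->
  exists y, active a (y :: s) x /\ ~ eventually_small f V x (y :: s).
Proof.
move=> sx; apply: contra_notP => /forallNP ys.
(* A child inactive at x is inactive near x, so that depth 0 serves vacuously. *)
have h y : exists n, \forall x' \near x, forall t, size t = n ->
    active a (t ++ y :: s) x' -> small_on f V (t ++ y :: s).
  have [yx|nyx] := pselect (active a (y :: s) x).
    by apply: contrapT => ny; apply: (ys y).
  exists 0; have : nbhs x (~` active a (y :: s)).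
    apply: open_nbhs_nbhs; split => //; apply: closed_openC; exact: closed_active.
  by apply: filterS => x' nyx' t _ /active_cat.
have [n nP] := choice h.
have [W xW finW] := active_locally_finite aP s x.
set A := [set i | _] in finW.
exists (\max_(y <- fset_set A) n y).+1.
have : \forall x' \near x, forall y, y \in finmap.enum_fset (fset_set A) -> forall t, size t = n y ->
    active a (t ++ y :: s) x' -> small_on f V (t ++ y :: s).
  elim: (finmap.enum_fset (fset_set A)) => [|y r IH]; first by apply: nearW.
  apply: filterS2 IH (nP y) => x' IH yP z; rewrite inE => /orP[/eqP -> //|].
  exact: IH.
apply: filterS2 xW => x' Wx' x'P t.
elim/last_ind: t => // t y _; rewrite size_rcons => -[tn]; rewrite cat_rcons => tx'.
have Ay : y \in fset_set A.
  rewrite in_fset_set// inE; split => //; exists x'; split => //.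
  exact: active_cat tx'.
have ny : (n y <= size t)%N by rewrite tn; apply: (@leq_bigmax_seq _ _ xpredT n y).
rewrite -(cat_take_drop (size t - n y) t) -catA in tx' *.
apply: small_on_cat; apply: x'P => //; last exact: active_cat tx'.
by rewrite size_drop subKn.
Qed.

(** An infinite branch of bad nodes active at x would have nested nonempty cells
    shrinking to a point p of Y, and continuity of f at p makes f small on one of
    them. *)
Lemma eventually_smallP f V x : continuous f -> nbhs (0 : E) V ->
  eventually_small f V x [::].
Proof.
move=> cf V0; apply: contrapT => nx.
have [y0 _] := Phi0 x.
have h s : exists y, active a s x -> ~ eventually_small f V x s ->
    active a (y :: s) x /\ ~ eventually_small f V x (y :: s).
  have [[sx ns]|] := pselect (active a s x /\ ~ eventually_small f V x s).
    by have [y yP] := eventually_small_step sx ns; exists y.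
  by move=> /not_andP ns; exists y0 => sx nsx; case: ns.
have [c cP] := choice h.
pose b := fix b k := if k is k'.+1 then c (b k') :: b k' else [::].
have bP k : active a (b k) x /\ ~ eventually_small f V x (b k).
  by elim: k => //= k [bx nb]; exact: cP.
have size_b k : size (b k) = k by elim: k => //= k ->.
have b_sub j k : (j <= k)%N -> cell (b k) `<=` cell (b j).
  move=> /subnK <-; elim: (k - j)%N => // m IH z; rewrite addSn => -[+ _].
  exact: IH.
pose F := filter_from [set: nat] (fun k => cell (b k)).
have PF : ProperFilter F.
  apply: filter_from_proper => [|k _].
    apply: filter_from_filter; first by exists 0.
    move=> j k _ _; exists (maxn j k) => // z bz.
    by split; apply: b_sub bz; rewrite ?leq_maxl ?leq_maxr.
  by have [z [_ ?]] := active_meets Phi0 aP (bP k).1; exists z.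
have cF : cauchy F.
  apply: cauchy_exP => e e0; have [k ke] := small_radius e0.
  exists (c (b k)), k.+1 => // z [_ /interior_subset]; rewrite size_b.
  by apply: le_ball; exact: ltW.
have [p Fp] := Y_complete PF cF.
have [W W0 WV] := nbhs0_split V0.
have [k _ bk] := Fp _ (cf p _ (nbhs_subl (f p) W0)).
case: (bP k) => _; apply; exists 0; apply: nearW => x' t /size0nil-> _ z z' /bk zW /bk z'W.
have [_] := WV _ _ zW z'W; by rewrite opprB addrA subrK.
Qed.

Lemma avg_close n (g h : seq Y -> X -> E) s x (V : set E) :
    convex_set V -> active a s x ->
    (forall t, size t = n -> active a (t ++ s) x ->
      V (g (t ++ s) x - h (t ++ s) x)) ->
  V (avg a n g s x - avg a n h s x).
Proof.
move=> cV sx ghV; rewrite addrC -scaleN1r -(avg_linear aP).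
by apply: (avg_convex aP) => // t tn tx; rewrite scaleN1r addrC; exact: ghV.
Qed.

Lemma level_small (f : Y -> E) (V : set E) (x : X) : continuous f -> nbhs (0 : E) V ->
  exists n, \forall x' \near x, forall t, (n < size t)%N -> active a t x' ->
    small_on f V t.
Proof.
move=> cf V0; have [n nP] := eventually_smallP x cf V0.
exists n; apply: filterS nP => x' nP t /ltnW nt tx'.
rewrite -(cat_take_drop (size t - n) t) in tx' *.
apply: small_on_cat; rewrite -[drop _ _]cats0; apply: nP.
  by rewrite size_drop subKn.
by rewrite cats0; exact: active_cat tx'.
Qed.

(** The root carries no point of Y, hence the default value 0; the averages of
    f proper start at level 1. *)
Definition leaf (f : Y -> E) (s : seq Y) (x : X) : E :=
  if s is y :: _ then f y else 0.

Definition level_avg (f : Y -> E) n x : E := avg a n (leaf f) [::] x.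

Lemma continuous_level_avg f n : continuous (level_avg f n).
Proof.
by apply: (continuous_avg aP) => -[|y s] x; exact: cvg_cst.
Qed.

Lemma level_avg_convex f n x (C : set E) : convex_set C ->
    (forall y s, active a (y :: s) x -> C (f y)) -> C (level_avg f n.+1 x).
Proof.
move=> cC fC; apply: (avg_convex aP) => // t; rewrite cats0.
by case: t => //= y t _; exact: fC.
Qed.

(** Below a node y :: s of the level at which f is small, the averages of f over
    the subtree lie in the convex set of the points close to f y. *)
Lemma level_avg_near_cauchy f V (x : X) : continuous f -> nbhs (0 : E) V ->
  exists n, \forall x' \near x, forall m, (n <= m)%N ->
    V (level_avg f m x' - level_avg f n x').
Proof.
move=> cf /nbhs0_convex[W [W0 cW WV]].
have [n nP] := level_small x cf W0.
exists n.+1; apply: filterS nP => x' nP m /subnKC <-.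
apply: WV; apply: subset_closure; rewrite /level_avg (avg_add a).
apply: avg_close => // t; rewrite cats0 => tn tx'.
have small_t : small_on f W t by apply: nP tx'; rewrite tn.
case: t tn tx' small_t => // y t tn tx' small_t.
apply: (avg_convex aP (C := [set v | W (v - f y)])) => //.
  exact: convex_set_translate.
move=> u _; case: u => [|z u] /=.
  by move=> _; apply: small_t; exact: (active_cell aP tx').
move=> ztx'; apply: small_t; last exact: (active_cell aP tx').
by have [/cell_cat] := active_cell aP ztx'.
Qed.

Lemma level_avg_linear f g (k : R) n x :
  level_avg (fun y => k *: f y + g y) n x = k *: level_avg f n x + level_avg g n x.
Proof.
rewrite /level_avg -(avg_linear aP); congr avg; apply/funext => -[|y s]; apply/funext => z //=.
by rewrite scaler0 addr0.
Qed.

(** The point c is the same average taken at points z t of Phi x in the cells of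
    the nodes t, instead of the heads of these nodes. *)
Lemma level_avg_near_hull f V (x : X) (C : set E) : continuous f -> nbhs (0 : E) V ->
    convex_set C -> f @` Phi x `<=` C ->
  exists n, forall m, (n < m)%N -> exists2 c, C c & V (level_avg f m x - c).
Proof.
move=> cf /nbhs0_convex[W [W0 cW WV]] cC fC.
have [n /nbhs_singleton nP] := level_small x cf W0.
have h t : exists z, active a t x -> Phi x z /\ cell t z.
  have [tx|] := pselect (active a t x); last by have [z _] := Phi0 x; exists z.
  by have [z [? ?]] := active_meets Phi0 aP tx; exists z.
have [z zP] := choice h.
exists n => m nm; exists (avg a m (fun t _ => f (z t)) [::] x).
  apply: (avg_convex aP) => // t _; rewrite cats0 => /zP[Phiz _].
  by apply: fC; exists (z t).
apply: WV; apply: subset_closure; apply: avg_close => // t; rewrite cats0 => tm tx.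
have small_t : small_on f W t by apply: nP tx; rewrite tm.
case: t tm tx small_t => [m0|y t tm tx]; first by rewrite -m0 in nm.
by apply; [exact: (active_cell aP tx)|have [] := zP _ tx].
Qed.

Context (E_std : standard_uniformity E) (E_complete : complete_space E).

Lemma level_avg_cvg f x : continuous f -> exists p : E, level_avg f n x @[n --> \oo] --> p.
Proof.
move=> cf; apply: (tvs_cauchy_cvg E_std E_complete) => U U0.
have [n /nbhs_singleton nP] := level_avg_near_cauchy x cf U0.
by exists n.
Qed.

Lemma level_avg_limit_continuous (f : Y -> E) (p : X -> E) : continuous f ->
  (forall x, level_avg f n x @[n --> \oo] --> p x) -> continuous p.
Proof.
move=> cf fp x A /nbhs0_addr U0.
have [W W0 WU] := nbhs0_split U0.
have [V V0 VW] := nbhs0_split W0.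
have [T [T0 _ TV]] := nbhs0_convex V0.
have [n nP] := level_avg_near_cauchy x cf T0.
have limP x' : (forall m, (n <= m)%N -> T (level_avg f m x' - level_avg f n x')) ->
    V (p x' - level_avg f n x').
  move=> Tx'; apply: TV => N pN.
  have /(_ N pN)[k _ kN] : (level_avg f m x' - level_avg f n x') @[m --> \oo] --> p x' - level_avg f n x'.
    by apply: tvs_cvgB; [exact: fp|exact: cvg_cst].
  exists (level_avg f (maxn n k) x' - level_avg f n x'); split.
    by apply: Tx'; exact: leq_maxl.
  by apply: kN; exact: leq_maxr.
have Vx := limP x (nbhs_singleton nP).
have cW : \forall x' \near x, W (level_avg f n x' - level_avg f n x).
  exact: (@continuous_level_avg f n x _ (nbhs_subl _ W0)).
apply: filterS2 nP cW => x' /limP Vx' Wxx'.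
have [_ Wd] := VW _ _ Vx' Vx.
have [+ _] := WU _ _ Wd Wxx'.
by rewrite /= opprB addrAC !subrKA addrC subrK.
Qed.

End limit.

(** * Nodes active on a compact set *)
Section heads.
Context (R : realType) (X : topologicalType) (Y : metricType R).
Context (Y_complete : complete_space Y).
Context (Phi : X -> set Y) (a : seq Y -> Y -> X -> R) (aP : selection_tree Phi a).

Lemma finite_active_nodes (K : set X) n : compact K ->
  finite_set [set s | size s = n /\ active a s `&` K !=set0].
Proof.
move=> cK; elim: n => [|n IH].
  by apply: sub_finite_set (finite_set1 [::]) => s [/size0nil].
apply: (@sub_finite_set _ _ (\bigcup_(s in [set s | size s = n /\ active a s `&` K !=set0])
   [set y :: s | y in [set y | active a (y :: s) `&` K !=set0]])).
  case=> [[]//|y s] [[sn] [x [sx Kx]]]; exists s => /=.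
    by split => //; exists x; split => //; case: sx.
  by exists y => //; exists x.
apply: bigcup_finite => // s _; apply: finite_image.
exact: locally_finite_compact (active_locally_finite aP s) cK.
Qed.

(** Up to level n there are finitely many heads, and each later head lies in the
    ball of radius 1/(n+1) around its ancestor at level n+1. *)
Lemma active_heads_compact (K : set X) : compact K ->
  exists2 L : set Y, compact L &
    forall x y s, K x -> active a (y :: s) x -> L y.
Proof.
move=> cK; pose L := [set y | exists s, active a (y :: s) `&` K !=set0].
exists (closure L); last first.
  by move=> x y s Kx sx; apply: subset_closure; exists s, x.
apply: totally_bounded_compact => // e e0.
have [n ne] := small_radius e0.
have fin_n k := finite_active_nodes k cK.
have [y0|nY] := pselect (exists y : Y, True); last first.
  by exists set0 => // y; exfalso; apply: nY; exists y.
case: y0 => y0 _.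
exists (\bigcup_(k in `I_n.+2) [set head y0 s | s in [set s | size s = k /\ active a s `&` K !=set0]]).
  by apply: bigcup_finite => // k _; exact: finite_image.
move=> y [s [x [sx Kx]]].
have [sn|ns] := ltnP (size s) n.+1.
  exists y; last exact: ballxx.
  exists (size s).+1 => //=; exists (y :: s) => //; split => //; by exists x.
(* The ancestor z :: t of y :: s at level n+1. *)
have /= [u [z [t [ut tn]]]] : exists u z t, u ++ z :: t = y :: s /\ size t = n.
  have := cat_take_drop (size s - n) (y :: s).
  have : size (drop (size s - n) (y :: s)) = n.+1.
    by rewrite size_drop /= subSn ?leq_subr// subKn// ltnW.
  case: (drop _ _) => //= z t [tn] tE.
  by exists (take (size s - n) (y :: s)), z, t.
exists z.
  exists n.+1 => //=; exists (z :: t) => //; split; first by rewrite /= tn.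
  by exists x; split => //; apply: (@active_cat _ _ _ a u); rewrite ut.
have : cell (y :: s) y := active_cell aP sx.
rewrite -ut => /cell_cat[_ /interior_subset]; rewrite tn.
by apply: le_ball; exact: ltW.
Qed.

End heads.

(** * The averaging operator and its continuity *)
Section operator.
Context (R : realType) (X : topologicalType) (Y : metricType R).
Context (Y_complete : complete_space Y).
Context (Phi : X -> set Y) (Phi0 : forall x, Phi x !=set0).
Context (a : seq Y -> Y -> X -> R) (aP : selection_tree Phi a).
Context (E : tvsType R) (E_std : standard_uniformity E).
Context (E_hausdorff : hausdorff_space E) (E_complete : complete_space E).

Lemma averaging_operator_exists :
  exists S : {linear continuousType Y E -> continuousType X E},
    forall (f : continuousType Y E) x, level_avg a f n x @[n --> \oo] --> S f x.
Proof.
have h (fx : continuousType Y E * X) : exists p : E,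
    level_avg a fx.1 n fx.2 @[n --> \oo] --> p.
  exact: (level_avg_cvg Y_complete Phi0 aP E_std E_complete _ (@cts_fun _ _ fx.1)).
have [p pP] := choice h.
have cp (f : continuousType Y E) : (fun x => p (f, x)) \in @cts_pred R X E.
  rewrite inE; apply: (level_avg_limit_continuous Y_complete Phi0 aP (@cts_fun _ _ f)).
  by move=> x; exact: (pP (f, x)).
pose S (f : continuousType Y E) : continuousType X E := cts_Sub (cp f).
have linS : linear S.
  move=> k f g; apply/val_inj; rewrite linearD linearZ; apply/funext => x.
  apply: (@cvg_unique _ E_hausdorff (level_avg a (k *: f + g : continuousType Y E) n x @[n --> \oo])).
    exact: (pP (_, x)).
  rewrite (_ : (fun n => _) = (fun n => k *: level_avg a f n x + level_avg a g n x)).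
    by apply: tvs_cvgD; [apply: tvs_cvgZ|]; exact: (pP (_, x)).
  by apply/funext => n; rewrite -(level_avg_linear aP).
pose SL : {linear continuousType Y E -> continuousType X E} :=
  HB.pack S (GRing.isLinear.Build R _ _ _ S linS).
by exists SL => f x; exact: (pP (f, x)).
Qed.

Lemma averaging_hull (f : Y -> E) x p : continuous f ->
  level_avg a f n x @[n --> \oo] --> p -> closed_convex_hull (f @` Phi x) p.
Proof.
move=> cf fp C [[clC cC] fC].
rewrite (closure_id C).1//; move=> N /nbhs0_addr /nbhs0_split[W W0 WN].
have [n nP] := level_avg_near_hull Y_complete Phi0 aP cf W0 cC fC.
have [k _ kP] := fp _ (nbhs_subl p W0).
have [c Cc cW] := nP (maxn n.+1 k) (leq_maxl _ _).
exists c; split => //.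
have [_] := WN _ _ (kP (maxn n.+1 k) (leq_maxr _ _)) cW.
by rewrite /= opprB [_ - p + _]addrC subrKA addrC subrK.
Qed.

(** Asking for V (f y) only at the heads y of nodes active at x gives both the
    uniform bound and the bound over a compact set of such heads. *)
Lemma averaging_bound (U : set E) : nbhs (0 : E) U ->
  exists2 V, nbhs (0 : E) V & forall (f : Y -> E) x p,
    level_avg a f n x @[n --> \oo] --> p ->
    (forall y s, active a (y :: s) x -> V (f y)) -> U p.
Proof.
move=> /nbhs0_convex[V [V0 cV VU]]; exists V => // f x p fp fV.
apply: VU => N /fp [n _ nN].
exists (level_avg a f n.+1 x); split; last by apply: nN; exact: leqnSn.
exact: (level_avg_convex aP).
Qed.

End operator.

Lemma ctsB_apply (R : realType) (X : topologicalType) (E : tvsType R)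
  (f g : continuousType X E) x : (f - g : continuousType X E) x = f x - g x.
Proof. by rewrite -[LHS]/(val (f - g) x) raddfB. Qed.

Lemma ctsZ_apply (R : realType) (X : topologicalType) (E : tvsType R)
  (k : R) (f : continuousType X E) x : (k *: f : continuousType X E) x = k *: f x.
Proof. by rewrite -[LHS]/(val (k *: f) x) linearZ. Qed.

Section continuity.
Context (R : realType) (X Y : topologicalType) (E : tvsType R).
Context (E_std : standard_uniformity E).
Context (S : {linear continuousType Y E -> continuousType X E}).

Lemma linear_continuous_unif :
    (forall U, nbhs (0 : E) U -> exists2 V, nbhs (0 : E) V &
      forall f : continuousType Y E, (forall y, V (f y)) -> forall x, U (S f x)) ->
  continuous (S : C_unif Y E -> C_unif X E).
Proof.
move=> SU; apply: continuous_comp_initial => f P.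
move=> /uniform_nbhs[A [entA AP]].
have [U U0 UA] : exists2 U, nbhs (0 : E) U & forall x y, U (x - y) -> A (x, y).
  by move: entA; rewrite E_std.
have [V V0 VU] := SU U U0.
have nV : nbhs (f : C_unif Y E) [set g : C_unif Y E | forall y, V (f y - g y)].
  have ic := @initial_continuous _ _
    (fun f : continuousType Y E => (f : {uniform Y -> E})) f.
  apply: (ic [set h | forall y, V (f y - h y)]).
  apply/uniform_nbhs; exists [set xy | V (xy.1 - xy.2)]; split.
    by rewrite E_std; exists V.
  by move=> h hV y; exact: hV.
apply: filterS nV => g fgV; apply: AP => x _; apply: UA => /=.
by rewrite -ctsB_apply -linearB; apply: VU => y; rewrite ctsB_apply; exact: fgV.
Qed.

Lemma linear_continuous_cpt :
    (forall K : set X, compact K -> exists2 L : set Y, compact L &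
      forall U, nbhs (0 : E) U -> exists2 V, nbhs (0 : E) V &
      forall f : continuousType Y E, (forall y, L y -> V (f y)) ->
        forall x, K x -> U (S f x)) ->
  continuous (S : C_cpt Y E -> C_cpt X E).
Proof.
move=> SU; apply: continuous_comp_initial => f.
have FF : Filter ((fun g : C_cpt Y E => S g : X -> E) @ f) by apply: fmap_filter; exact: nbhs_filter.
apply/(fam_cvgP _ _ FF) => K cK P /uniform_nbhs[A [entA AP]].
have [L cL LP] := SU K cK.
have [U U0 UA] : exists2 U, nbhs (0 : E) U & forall x y, U (x - y) -> A (x, y).
  by move: entA; rewrite E_std.
have [V V0 VU] := LP U U0.
have nV : nbhs (f : C_cpt Y E) [set g : C_cpt Y E | forall y, L y -> V (f y - g y)].
  have ic := @initial_continuous _ _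
    (fun f : continuousType Y E => (f : {family (@compact Y), Y -> E})) f.
  apply: (ic [set h | forall y, L y -> V (f y - h y)]).
  apply: (@fam_nbhs _ _ _ L [set xy | V (xy.1 - xy.2)]) => //.
  by rewrite E_std; exists V.
apply: filterS nV => g fgV; apply: AP => x Kx; apply: UA => /=.
rewrite -ctsB_apply -linearB; apply: VU Kx => y Ly; rewrite ctsB_apply.
exact: fgV.
Qed.

End continuity.

Section restriction.
Context (R : realType) (X Y : topologicalType) (E : tvsType R).
Context (S : {linear continuousType Y E -> continuousType X E}).

(** If f takes its values in t *: V then S f takes its values in t *: U, by
    linearity applied to t^-1 *: f. *)
Lemma linear_bounded_restriction :
    (forall U, nbhs (0 : E) U -> exists2 V, nbhs (0 : E) V &
      forall f : continuousType Y E, (forall y, V (f y)) -> forall x, U (S f x)) ->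
  exists Sb : {linear bounded_cts Y E -> bounded_cts X E},
    forall f, val (Sb f) = S (val f).
Proof.
move=> SU.
have bS (f : bounded_cts Y E) : S (val f) \in @bounded_cts_pred R X E.
  rewrite inE => U /SU[V V0 VU].
  have := set_mem (valP f) V V0.
  have : \forall t \near +oo_R, 0 < t by exact: nbhs_pinfty_gt.
  apply: filterS2 => t t0 ft _ [x _ <-].
  exists (t^-1 *: S (val f) x); last by rewrite scalerA divff ?scale1r// gt_eqF.
  rewrite -ctsZ_apply -linearZ; apply: VU => y; rewrite ctsZ_apply.
  have [|u Vu <-] := ft (val f y); first by exists y.
  by rewrite scalerA mulVf ?scale1r// gt_eqF.
pose Sb (f : bounded_cts Y E) : bounded_cts X E := exist _ (S (val f)) (bS f).
have linSb : linear Sb.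
  by move=> k f g; apply/val_inj; rewrite /= !linearP.
pose SbL : {linear bounded_cts Y E -> bounded_cts X E} :=
  HB.pack Sb (GRing.isLinear.Build R _ _ _ Sb linSb).
by exists SbL.
Qed.

Lemma restriction_continuous_unif (Sb : bounded_cts Y E -> bounded_cts X E) :
  (forall f, val (Sb f) = S (val f)) ->
  continuous (S : C_unif Y E -> C_unif X E) ->
  continuous (Sb : Cb_unif Y E -> Cb_unif X E).
Proof.
move=> SbE cS; apply: continuous_comp_initial.
rewrite (_ : _ \o _ = S \o val); last by apply/funext => f; exact: SbE.
move=> f; apply: (@continuous_comp _ _ _ (val : Cb_unif Y E -> C_unif Y E)).
  exact: (@initial_continuous _ _ (fun f : bounded_cts Y E => (val f : C_unif Y E)) f).
exact: cS.
Qed.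

Lemma restriction_continuous_cpt (Sb : bounded_cts Y E -> bounded_cts X E) :
  (forall f, val (Sb f) = S (val f)) ->
  continuous (S : C_cpt Y E -> C_cpt X E) ->
  continuous (Sb : Cb_cpt Y E -> Cb_cpt X E).
Proof.
move=> SbE cS; apply: continuous_comp_initial.
rewrite (_ : _ \o _ = S \o val); last by apply/funext => f; exact: SbE.
move=> f; apply: (@continuous_comp _ _ _ (val : Cb_cpt Y E -> C_cpt Y E)).
  exact: (@initial_continuous _ _ (fun f : bounded_cts Y E => (val f : C_cpt Y E)) f).
exact: cS.
Qed.

End restriction.

Theorem theorem1p2 (R : realType) (X : topologicalType) (Y : metricType R)
    (Phi : X -> set Y)
    (X_paracompact : paracompact X)
    (Y_complete : complete_space Y)
    (Phi_lsc : lower_semi_continuous Phi)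
    (Phi_neq0 : forall x, Phi x !=set0)
    (E : tvsType R)
    (E_std : standard_uniformity E)
    (E_hausdorff : hausdorff_space E)
    (E_complete : complete_space E) :
  exists Sb : {linear bounded_cts Y E -> bounded_cts X E},
    [/\ forall (x : X) (f : bounded_cts Y E),
          closed_convex_hull (val f @` Phi x) (val (Sb f) x),
        continuous (Sb : Cb_unif Y E -> Cb_unif X E),
        continuous (Sb : Cb_cpt Y E -> Cb_cpt X E)
      & k_space X \/ banach_space E ->
        exists S : {linear continuousType Y E -> continuousType X E},
          [/\ forall f : bounded_cts Y E, S (val f) = val (Sb f),
              forall (x : X) (f : continuousType Y E),
                closed_convex_hull (f @` Phi x) (S f x),
              continuous (S : C_unif Y E -> C_unif X E)
            & continuous (S : C_cpt Y E -> C_cpt X E)]].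
Proof.
have [a aP] := selection_tree_exists X_paracompact Phi_lsc Phi_neq0.
have [S SP] := averaging_operator_exists Y_complete Phi_neq0 aP E_std
  E_hausdorff E_complete.
have hull x (f : continuousType Y E) : closed_convex_hull (f @` Phi x) (S f x).
  exact: (averaging_hull Y_complete Phi_neq0 aP (@cts_fun _ _ f) (SP f x)).
have bound U : nbhs (0 : E) U -> exists2 V, nbhs (0 : E) V &
    forall f : continuousType Y E, (forall y, V (f y)) -> forall x, U (S f x).
  move=> /(averaging_bound aP)[V V0 VU]; exists V => // f fV x.
  by apply: VU (SP f x) _ => y s _.
have contS : continuous (S : C_unif Y E -> C_unif X E).
  exact: linear_continuous_unif.
have contS_cpt : continuous (S : C_cpt Y E -> C_cpt X E).
  apply: linear_continuous_cpt => // K cK.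
  have [L cL LP] := active_heads_compact Y_complete aP cK.
  exists L => // U /(averaging_bound aP)[V V0 VU]; exists V => // f fV x Kx.
  by apply: VU (SP f x) _ => y s sx; apply: fV; exact: LP sx.
have [Sb SbP] := linear_bounded_restriction bound.
exists Sb; split.
- by move=> x f; rewrite SbP.
- exact: restriction_continuous_unif SbP contS.
- exact: restriction_continuous_cpt SbP contS_cpt.
- by move=> _; exists S; split=> // f; rewrite SbP.
Qed.
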